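(* Let $k,t\geq 2$ and $s$ be positive integers. There exists a constant $C=C(k,t,s)$ such that the following holds. Let $G=(V,E)$ be a graph with $n$ vertices and at least $Cn^{1+1/k}$ edges. Let $\sim$ be a symmetric binary relation on $V$ such that for all $u,v\in V$, $v$ has at most $s$ neighbours $w$ with $u\sim w$. Let $\approx$ be a binary relation on $E$ such that for every $uv\in E$ and $w\in V$, $w$ has at most $s$ neighbours $z$ with $uv\approx wz$. Then $G$ contains a subgraph isomorphic to $\theta_{k,t}$ which contains no two distinct vertices related by $\sim$ and no two distinct edges related by $\approx$.
   Context: The theta graph $\theta_{k,t}$ is the union of $t$ paths of length $k$ which share the same two endpoints but are pairwise internally vertex-disjoint. *)

(* Defs.v *)
From mathcomp Require Import all_boot.
From Stdlib Require Import Reals.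
Set Implicit Arguments. Unset Strict Implicit. Unset Printing Implicit Defensive.

Definition simple_graph (T : finType) (adj : rel T) : Prop :=
  symmetric adj /\ irreflexive adj.

Definition edge_set (T : finType) (adj : rel T) : {set {set T}} :=
  [set e : {set T} | [exists u, exists v, adj u v && (e == [set u; v])]].

(* A copy of theta_{k,t} in the graph: t paths p i 0, ..., p i k of length k,
   all from x = p i 0 to y = p i k, consecutive vertices adjacent,
   with all vertices distinct except the shared endpoints. *)
Definition theta_copy (T : finType) (adj : rel T) (k t : nat)
    (x y : T) (p : 'I_t -> nat -> T) : Prop :=
  (forall i, p i 0 = x /\ p i k = y) /\
  (forall i j, j < k -> adj (p i j) (p i j.+1)) /\
  (forall i i' j j', j <= k -> j' <= k -> p i j = p i' j' ->
      j = j' /\ (i = i' \/ j = 0 \/ j = k)).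

Definition vertex_good (T : finType) (sim : rel T) (k t : nat)
    (p : 'I_t -> nat -> T) : Prop :=
  forall i i' j j', j <= k -> j' <= k -> p i j != p i' j' ->
    ~~ sim (p i j) (p i' j').

Definition edge_good (T : finType) (approx : rel {set T}) (k t : nat)
    (p : 'I_t -> nat -> T) : Prop :=
  forall i i' j j', j < k -> j' < k ->
    [set p i j; p i j.+1] != [set p i' j'; p i' j'.+1] ->
    ~~ approx [set p i j; p i j.+1] [set p i' j'; p i' j'.+1].

(* Main.v *)
(* A closed walk of length 2k through x and y consists of two walks of length k
from x to y, so it suffices to find x and y for which all but a tiny proportion
of the pairs of walks from x to y close up to a good closed walk (distinct
vertices, no related vertices or edges): t pairwise good walks can then be
chosen greedily, and they form the theta graph.

After passing to a subgraph of minimum degree d, where d^k is a large multiple of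
n, a closed walk is weighted by the product of the inverse degrees of its
vertices; this makes any bound on the maximum degree unnecessary.  Let w_i be the
total weight of the closed walks of length 2i.  After a rotation and possibly a
reversal, a bad closed walk x_0 x_1 ... has a relation between x_0 (or x_0 x_1)
and x_l (or x_l x_(l+1)) with 1 <= l <= k, so that x_0 is one of O(s) neighbours
of x_1 determined by x_1, ..., x_(k+1).  Two applications of Cauchy-Schwarz bound
the bad weight by a constant times (s w_k w_(k-1) / d)^(1/2).  Finally w_i is
log-convex with w_0 = n and w_k >= 1, whence w_(k-1) <= n^(1/k) w_k. *)
Require Import Defs.
From mathcomp Require Import all_boot all_order all_algebra.
From mathcomp Require Import ring lra zify.
Set Implicit Arguments. Unset Strict Implicit. Unset Printing Implicit Defensive.

(** * Sums over tuples: splitting, rotation, reversal *)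

Section SumTuple.
Import GRing.Theory.
Local Open Scope ring_scope.
Variables (T : finType) (V : nmodType).
Implicit Types (F : seq T -> V).

Lemma sum_tuple0 F : \sum_(t : 0.-tuple T) F t = F [::].
Proof.
rewrite (big_pred1 [tuple]) // => t; rewrite /= [t]tuple0; symmetry; exact: eqxx.
Qed.

Lemma sum_tuple_cons n F :
  \sum_(t : n.+1.-tuple T) F t = \sum_x \sum_(t : n.-tuple T) F (x :: t).
Proof.
rewrite pair_big /= (reindex (fun xt : T * n.-tuple T => [tuple of xt.1 :: xt.2])) //=.
exists (fun t : n.+1.-tuple T => (thead t, [tuple of behead t])).
  by move=> [x t] _ /=; congr pair; apply: val_inj.
by move=> t _ /=; rewrite [RHS]tuple_eta.
Qed.

Lemma sum_tuple_rcons n F :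
  \sum_(t : n.+1.-tuple T) F t = \sum_x \sum_(t : n.-tuple T) F (rcons t x).
Proof.
elim: n F => [|n IHn] F.
  rewrite sum_tuple_cons; apply: eq_bigr => x _.
  by rewrite (sum_tuple0 (fun s => F (x :: s))) (sum_tuple0 (fun s => F (rcons s x))).
rewrite sum_tuple_cons.
under eq_bigr => x _ do rewrite (IHn (fun s => F (x :: s))).
rewrite exchange_big /=; apply: eq_bigr => y _.
by rewrite (sum_tuple_cons n (fun s => F (rcons s y))).
Qed.

Lemma sum_tuple_cat m n F :
  \sum_(t : (m + n).-tuple T) F t =
  \sum_(p : m.-tuple T) \sum_(q : n.-tuple T) F (p ++ q).
Proof.
elim: m F => [|m IHm] F.
  by rewrite (sum_tuple0 (fun p => \sum_(q : n.-tuple T) F (p ++ q))).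
rewrite sum_tuple_cons (sum_tuple_cons m (fun p => \sum_(q : n.-tuple T) F (p ++ q))).
by apply: eq_bigr => x _; rewrite (IHm (fun s => F (x :: s))).
Qed.

Lemma sum_tuple_rot1 n F :
  \sum_(t : n.-tuple T) F (rot 1 t) = \sum_(t : n.-tuple T) F t.
Proof.
case: n => [|n]; first by rewrite !(sum_tuple0 (fun s => F (rot 1 s)), sum_tuple0).
rewrite (sum_tuple_cons n (fun s => F (rot 1 s))) sum_tuple_rcons.
by apply: eq_bigr => x _; apply: eq_bigr => t _; rewrite rot1_cons.
Qed.

Lemma sum_tuple_rot n i F : (i <= n)%N ->
  \sum_(t : n.-tuple T) F (rot i t) = \sum_(t : n.-tuple T) F t.
Proof.
elim: i => [|i IHi] lt_in; first by apply: eq_bigr => t _; rewrite rot0.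
rewrite -(IHi (ltnW lt_in)) -(sum_tuple_rot1 n (fun s => F (rot i s))).
by apply: eq_bigr => t _; rewrite -rotD ?addn1 // size_tuple.
Qed.

Lemma sum_tuple_rev n F :
  \sum_(t : n.-tuple T) F (rev t) = \sum_(t : n.-tuple T) F t.
Proof.
elim: n F => [|n IHn] F; first by rewrite !(sum_tuple0 (fun s => F (rev s)), sum_tuple0).
rewrite (sum_tuple_cons n (fun s => F (rev s))) sum_tuple_rcons.
apply: eq_bigr => x _; rewrite -(IHn (fun s => F (rcons s x))).
by apply: eq_bigr => t _; rewrite rev_cons.
Qed.

End SumTuple.

(** * Cauchy-Schwarz and greedy selection *)

Section Inequalities.
Import Order.TTheory GRing.Theory Num.Theory.
Local Open Scope ring_scope.
Variable R : realFieldType.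

(** Lagrange's identity: the sum over [i] and [j] of [w i * w j * (f i * g j - f j * g i) ^+ 2] is
    twice the right side minus the left side. *)
Lemma weighted_cauchy_schwarz (I : finType) (w f g : I -> R) :
  (forall i, 0 <= w i) ->
  (\sum_i w i * (f i * g i)) ^+ 2 <=
    (\sum_i w i * f i ^+ 2) * (\sum_i w i * g i ^+ 2).
Proof.
move=> w0; set A := \sum_i _; set B := \sum_i w i * f i ^+ 2.
set C := \sum_i w i * g i ^+ 2.
have : 0 <= \sum_i \sum_j w i * w j * (f i * g j - f j * g i) ^+ 2.
  by apply: sumr_ge0 => i _; apply: sumr_ge0 => j _; rewrite mulr_ge0 ?sqr_ge0 ?mulr_ge0.
have BC : B * C = \sum_i \sum_j w i * f i ^+ 2 * (w j * g j ^+ 2).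
  by rewrite /B /C big_distrlr.
have CB : B * C = \sum_i \sum_j w i * g i ^+ 2 * (w j * f j ^+ 2).
  by rewrite mulrC /B /C big_distrlr.
have AA : A ^+ 2 = \sum_i \sum_j w i * (f i * g i) * (w j * (f j * g j)).
  by rewrite expr2 /A big_distrlr.
rewrite [X in 0 <= X](_ : _ = B * C + B * C - A ^+ 2 - A ^+ 2); first by lra.
rewrite {1}BC CB AA -!sumrN -!big_split /=; apply: eq_bigr => i _.
rewrite -!sumrN -!big_split /=; apply: eq_bigr => j _; ring.
Qed.

(* Greedy choice: an element whose bad neighbourhood is at most half of the mass is kept, and deleting that neighbourhood at most quadruples the density of bad pairs. *)
Lemma pairwise_good_selection (I : finType) (bad : rel I) (t : nat) (w : I -> R) :
  (forall i, 0 <= w i) -> 0 < \sum_i w i ->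
  4 ^+ t * (\sum_i \sum_j w i * w j * (bad i j)%:R) <= (\sum_i w i) ^+ 2 ->
  exists l : seq I, [/\ size l = t, all (fun i => 0 < w i) l
                      & pairwise (fun i j => ~~ bad i j) l].
Proof.
elim: t w => [|t IHt] w w0 W_gt0 sparse; first by exists [::].
set W := \sum_i w i in W_gt0 sparse.
pose beta i := \sum_j w j * (bad i j)%:R.
have beta0 i : 0 <= beta i by apply: sumr_ge0 => j _; rewrite mulr_ge0.
have four_ge1 n : 1 <= 4 ^+ n :> R by rewrite exprn_ege1 // ler1n.
set B := \sum_i _ in sparse.
have B_def : B = \sum_i w i * beta i.
  by apply: eq_bigr => i _; rewrite mulr_sumr; apply: eq_bigr => j _; rewrite mulrA.
have B0 : 0 <= B by rewrite B_def; apply: sumr_ge0 => i _; rewrite mulr_ge0.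
(* Otherwise every [i] of positive weight has [2 * beta i > W], so that [W ^+ 2 <= 2 * B], against
   [sparse]. *)
have [i /andP[wi_gt0 beta_le]] : exists i, (0 < w i) && (2 * beta i <= W).
  apply/existsP; apply: contraLR sparse; rewrite negb_exists -ltNge => /forallP H.
  have WW : W ^+ 2 <= 2 * B.
    rewrite expr2 {1}/W mulr_suml B_def mulr_sumr; apply: ler_sum => i _.
    have := w0 i; rewrite le_eqVlt => /orP[/eqP<-|wi]; first by rewrite !mul0r mulr0.
    have := H i; rewrite wi /= -ltNge mulrCA => /ltW; exact: ler_wpM2l.
  have W2 : 0 < W ^+ 2 by rewrite exprn_gt0.
  have := ler_wpM2r B0 (four_ge1 t); rewrite [4 ^+ _.+1]exprS; lra.
(* Deletion sets weights to zero, which keeps the index type fixed in the induction. *)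
pose w' j := w j * (~~ bad i j)%:R.
have w'0 j : 0 <= w' j by rewrite mulr_ge0.
have w'_le j : w' j <= w j by rewrite ler_piMr // lern1 leq_b1.
have W'_def : \sum_j w' j = W - beta i.
  rewrite -sumrB; apply: eq_bigr => j _.
  by rewrite /w'; case: (bad i j); rewrite /= ?mulr0 ?mulr1 ?subrr ?subr0.
have := IHt w' w'0; rewrite W'_def => IH.
have [||l [<- /allP w'_gt0 good]] := IH.
- by have := beta0 i; lra.
- have B'_le : \sum_j \sum_l w' j * w' l * (bad j l)%:R <= B.
    apply: ler_sum => j _; apply: ler_sum => l _; rewrite ler_wpM2r //.
    exact: ler_pM.
  have W2 : W ^+ 2 <= 4 * (W - beta i) ^+ 2 by have := beta0 i; nra.
  have := ler_wpM2l (le_trans ler01 (four_ge1 t)) B'_le.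
  by move: sparse; rewrite [4 ^+ _.+1]exprS; lra.
exists (i :: l).
have lP j : j \in l -> (0 < w j) && ~~ bad i j.
  move=> /w'_gt0; rewrite /w'; case: (bad i j) => /=; rewrite ?mulr0 ?ltxx //.
  by rewrite mulr1 => ->.
split=> //=; first by rewrite wi_gt0; apply/allP => j /lP/andP[].
by rewrite good andbT; apply/allP => j /lP/andP[].
Qed.

End Inequalities.

(** * Degree-weighted walks and closed walks *)

Section WeightedWalks.
Import Order.TTheory GRing.Theory Num.Theory.
Local Open Scope ring_scope.
Variables (R : realFieldType) (T : finType) (adj : rel T).
Hypothesis adj_sym : symmetric adj.
Implicit Types (x y z : T) (p q s : seq T).

Definition deg x : nat := #|[set y | adj x y]|.
(* An isolated vertex gets weight [0^-1 = 0]. *)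
Definition vwt x : R := (deg x)%:R^-1.
(** Only the interior vertices [p] are weighted, so that a closed walk factors into two arcs and the
    weights of the two cut vertices. Hence [walks m] concerns walks with [m.+1] edges. *)
Definition walk_wt x p y : R :=
  (path adj x (rcons p y))%:R * \prod_(v <- p) vwt v.
Definition walks m x y : R := \sum_(p : m.-tuple T) walk_wt x p y.
Definition cycle_wt s : R := (cycle adj s)%:R * \prod_(v <- s) vwt v.
(** For positive [n], the trace of the [n]-th power of the random walk operator. *)
Definition closed_walks n : R := \sum_(s : n.-tuple T) cycle_wt s.

Lemma vwt_ge0 x : 0 <= vwt x. Proof. by rewrite invr_ge0. Qed.

Lemma prod_vwt_ge0 s : 0 <= \prod_(v <- s) vwt v.
Proof. by apply: prodr_ge0 => v _; apply: vwt_ge0. Qed.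

Lemma walk_wt_ge0 x p y : 0 <= walk_wt x p y.
Proof. by rewrite mulr_ge0 ?prod_vwt_ge0. Qed.

Lemma cycle_wt_ge0 s : 0 <= cycle_wt s.
Proof. by rewrite mulr_ge0 ?prod_vwt_ge0. Qed.

Lemma walks_ge0 m x y : 0 <= walks m x y.
Proof. by apply: sumr_ge0 => p _; apply: walk_wt_ge0. Qed.

Lemma sum_adj x : \sum_y (adj x y)%:R = (deg x)%:R :> R.
Proof.
rewrite /deg -sum1_card natr_sum [RHS]big_mkcond; apply: eq_bigr => y _.
by rewrite inE; case: (adj x y).
Qed.

Lemma walk_wt_cons x z p y :
  walk_wt x (z :: p) y = (adj x z)%:R * (vwt z * walk_wt z p y).
Proof. by rewrite /walk_wt /= big_cons -mulnb natrM -!mulrA [in RHS](mulrCA (vwt z)). Qed.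

Lemma cycle_wt_cat x p y q :
  cycle_wt (x :: p ++ y :: q) =
  vwt x * vwt y * (walk_wt x p y * walk_wt y q x).
Proof.
rewrite /cycle_wt /walk_wt /= rcons_cat /= cat_path /= [path adj x (rcons p y)]rcons_path.
rewrite big_cons big_cat big_cons /= -!mulnb !natrM.
move: (path _ _ _)%:R (adj _ _)%:R (path _ _ _)%:R => a b c; ring.
Qed.

Lemma cycle_wt_rot i s : cycle_wt (rot i s) = cycle_wt s.
Proof. by rewrite /cycle_wt rot_cycle (perm_big s) //= perm_rot. Qed.

Lemma cycle_wt_rev s : cycle_wt (rev s) = cycle_wt s.
Proof.
rewrite /cycle_wt rev_cycle (perm_big s) ?perm_rev //.
by rewrite (eq_cycle (fun x y => adj_sym y x)).
Qed.

Lemma walk_wt_rev x p y : walk_wt x (rev p) y = walk_wt y p x.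
Proof.
rewrite /walk_wt (perm_big p) ?perm_rev //=; congr (_ %:R * _).
have := rev_path adj y (rcons p x); rewrite last_rcons belast_rcons rev_cons => ->.
by rewrite (eq_path (fun x y => adj_sym y x)).
Qed.

Lemma walksC m x y : walks m x y = walks m y x.
Proof.
rewrite /walks -(sum_tuple_rev m (fun p => walk_wt x p y)).
by apply: eq_bigr => p _; rewrite walk_wt_rev.
Qed.

Lemma walks0 x y : walks 0 x y = (adj x y)%:R.
Proof.
by rewrite /walks (sum_tuple0 (fun p => walk_wt x p y)) /walk_wt /= andbT big_nil mulr1.
Qed.

Lemma walksS m x y :
  walks m.+1 x y = \sum_z (adj x z)%:R * (vwt z * walks m z y).
Proof.
rewrite /walks (sum_tuple_cons m (fun p => walk_wt x p y)).
apply: eq_bigr => z _; rewrite !mulr_sumr.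
by apply: eq_bigr => p _; rewrite walk_wt_cons.
Qed.

Lemma deg_gt0 x y : adj x y -> (0 < deg y)%N.
Proof. by move=> xy; apply/card_gt0P; exists x; rewrite inE adj_sym. Qed.

Lemma vwtK x y : adj x y -> vwt y * (deg y)%:R = 1.
Proof. by move=> /deg_gt0 d0; rewrite mulVf // pnatr_eq0 -lt0n. Qed.

(** By induction, the tails sum to the degree of the first interior vertex, which cancels its
    weight. *)
Lemma sum_walks m x : \sum_y walks m x y = (deg x)%:R.
Proof.
elim: m x => [|m IHm] x.
  by rewrite -sum_adj; apply: eq_bigr => y _; rewrite walks0.
under eq_bigr => y _ do rewrite walksS.
rewrite exchange_big -sum_adj /=; apply: eq_bigr => z _.
rewrite -!mulr_sumr IHm; case: (boolP (adj x z)) => [xz|_]; last by rewrite mul0r.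
by rewrite (vwtK xz) mulr1.
Qed.

(** The delicate case is [deg x = 0]: the walks from [x] are nonnegative with sum [deg x], so they
    vanish as well. *)
Lemma walks_degK m x y : (deg x)%:R * vwt x * walks m x y = walks m x y.
Proof.
have [dx0|dx_gt0] := posnP (deg x); last first.
  by rewrite mulfV ?mul1r // pnatr_eq0 -lt0n.
have /eqP : \sum_y walks m x y = 0 by rewrite sum_walks dx0.
rewrite psumr_eq0 => [/allP/(_ y)|*]; last exact: walks_ge0.
by rewrite mem_index_enum => /(_ isT)/eqP->; rewrite mulr0.
Qed.

Lemma sum_closed_split m n (F : seq T -> R) :
  \sum_(s : (m.+1 + n.+1).-tuple T) F s =
  \sum_x \sum_y \sum_(p : m.-tuple T) \sum_(q : n.-tuple T) F (x :: p ++ y :: q).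
Proof.
rewrite sum_tuple_cat (sum_tuple_cons m (fun p => \sum_(q : _.-tuple T) F (p ++ q))).
apply: eq_bigr => x _; rewrite [RHS]exchange_big /=; apply: eq_bigr => p _.
by rewrite (sum_tuple_cons n (fun q => F (x :: p ++ q))).
Qed.

Lemma closed_walks_split m n :
  closed_walks (m.+1 + n.+1) =
  \sum_x \sum_y vwt x * vwt y * (walks m x y * walks n x y).
Proof.
rewrite /closed_walks sum_closed_split; apply: eq_bigr => x _.
apply: eq_bigr => y _; rewrite [walks n x y]walksC /walks big_distrlr mulr_sumr /=.
apply: eq_bigr => p _; rewrite mulr_sumr; apply: eq_bigr => q _.
exact: cycle_wt_cat.
Qed.

(* The spectral moments of the walk operator are log-convex. *)
Lemma closed_walks_cauchy_schwarz m n :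
  closed_walks (m.+1 + n.+1) ^+ 2 <=
  closed_walks (m.+1 + m.+1) * closed_walks (n.+1 + n.+1).
Proof.
rewrite !closed_walks_split !pair_big /=.
apply: (weighted_cauchy_schwarz (fun u => walks m u.1 u.2) (fun u => walks n u.1 u.2)).
by move=> u; rewrite mulr_ge0 ?vwt_ge0.
Qed.

(** Start of the log-convexity chain, with [#|T|] as zeroth moment: [closed_walks 2] is the sum of
    [vwt x * walks 1 x x], and the squares of these summands are the diagonal terms of
    [closed_walks 4]. *)
Lemma closed_walks2_le : closed_walks 2 ^+ 2 <= #|T|%:R * closed_walks 4.
Proof.
have diag : closed_walks 2 = \sum_x 1 * (1 * (vwt x * walks 1 x x)).
  rewrite (closed_walks_split 0 0); apply: eq_bigr => x _.
  rewrite walksS !mul1r mulr_sumr; apply: eq_bigr => y _.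
  by rewrite !walks0 [adj y x]adj_sym; ring.
have := weighted_cauchy_schwarz (w := fun=> 1 : R) (fun=> 1)
  (fun x => vwt x * walks 1 x x) (fun=> ler01).
rewrite -diag => /le_trans; apply; apply: ler_pM.
- by apply: sumr_ge0 => x _; rewrite expr1n mulr1.
- by apply: sumr_ge0 => x _; rewrite mul1r sqr_ge0.
- by under eq_bigr => x _ do rewrite expr1n mulr1; rewrite sumr_const.
rewrite (closed_walks_split 1 1); apply: ler_sum => x _.
rewrite (bigD1 x) //= mul1r exprMn -!expr2 lerDl.
by apply: sumr_ge0 => y _; rewrite mulr_ge0 ?mulr_ge0 ?vwt_ge0 ?walks_ge0.
Qed.

(* The degree vector is an eigenvector of the walk operator for the eigenvalue 1. *)
Lemma closed_walks_ge1 m x0 y0 : adj x0 y0 -> 1 <= closed_walks (m.+1 + m.+1).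
Proof.
move=> x0y0; pose D : R := \sum_x (deg x)%:R.
have D_gt0 : 0 < D.
  rewrite /D (bigD1 y0) //= ltr_pwDl ?ltr0n ?(deg_gt0 x0y0) //.
  by apply: sumr_ge0.
(* For this measure the constant 1 has squared norm [D ^+ 2], the squared norm of [f] is the moment,
   and their inner product is [D]. *)
pose w (u : T * T) : R := (deg u.1)%:R * (deg u.2)%:R.
have w0 u : 0 <= w u by rewrite mulr_ge0.
pose f (u : T * T) := vwt u.1 * vwt u.2 * walks m u.1 u.2.
have degK2 x y : (deg x)%:R * vwt x * ((deg y)%:R * vwt y) * walks m x y = walks m x y.
  by rewrite -mulrA [walks m x y in LHS]walksC walks_degK walksC walks_degK.
have sum_w : \sum_u w u * 1 ^+ 2 = D ^+ 2.
  rewrite [D ^+ 2]expr2 /D big_distrlr pair_big /=.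
  by apply: eq_bigr => u _; rewrite expr1n mulr1.
have sum_wf : \sum_u w u * (f u * 1) = D.
  rewrite -(pair_big xpredT xpredT (fun x y => w (x, y) * (f (x, y) * 1))) /=.
  apply: eq_bigr => x _; rewrite -(sum_walks m); apply: eq_bigr => y _.
  by rewrite -[RHS]degK2 /w /f /=; ring.
have sum_wff : \sum_u w u * f u ^+ 2 = closed_walks (m.+1 + m.+1).
  rewrite closed_walks_split pair_big; apply: eq_bigr => -[x y] _ /=.
  by rewrite -[X in _ = _ * (X * _)]degK2 /w /f /=; ring.
have := weighted_cauchy_schwarz f (fun=> 1) w0.
rewrite sum_w sum_wf sum_wff -[leLHS]mul1r ler_pM2r //.
by rewrite exprn_gt0.
Qed.

(* Cauchy-Schwarz is applied twice, first over the pair of vertices cutting the closed walk into arcs of [j + 3] and [j + 1] edges, then over the second vertex. *)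
Lemma sparse_event_bound (beta : pred (seq T)) (sigma delta j : nat) :
  (forall x, (0 < deg x -> delta <= deg x)%N) ->
  (forall x p z, path adj x (rcons p z) -> size p = j.+1 ->
    #|[set y | adj y x && beta (y :: x :: rcons p z)]| <= sigma)%N ->
  delta%:R *
    (\sum_(s : (j.+3 + j.+1).-tuple T) cycle_wt s * (beta (take j.+4 s))%:R) ^+ 2 <=
  sigma%:R * (closed_walks (j.+2 + j.+2) * closed_walks (j.+1 + j.+1)).
Proof.
move=> deg_min sparse.
pose b y x z := \sum_(p : j.+1.-tuple T)
  walk_wt x p z * (beta (y :: x :: rcons p z))%:R.
(* The mass of the walks with [j.+3] edges from [y] to [z] that satisfy [beta], split at the first
   interior vertex; the factor [1] matches the form of Cauchy-Schwarz. *)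
pose B y z := \sum_x (adj y x)%:R * (1 * (vwt x * b y x z)).
have b_ge0 y x z : 0 <= b y x z.
  by apply: sumr_ge0 => p _; rewrite mulr_ge0 ?walk_wt_ge0.
have b_le y x z : b y x z <= walks j.+1 x z.
  by apply: ler_sum => p _; rewrite ler_piMr ?walk_wt_ge0 ?lern1 ?leq_b1.
(* Once the walk from [x] to [z] is fixed, at most [sigma] start vertices [y] satisfy [beta]. *)
have sum_b x z : \sum_y (adj y x)%:R * b y x z <= sigma%:R * walks j.+1 x z.
  under eq_bigr => y _ do rewrite mulr_sumr.
  rewrite exchange_big mulr_sumr /=; apply: ler_sum => p _.
  have [pth|npth] := boolP (path adj x (rcons p z)); last first.
    rewrite big1 => [|y _]; first by rewrite mulr_ge0 ?walk_wt_ge0.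
    by rewrite /walk_wt (negPf npth) !(mul0r, mulr0).
  under eq_bigr => y _ do rewrite mulrCA mulrC -natrM mulnb.
  rewrite -mulr_suml ler_wpM2r ?walk_wt_ge0 //.
  rewrite -natr_sum ler_nat (leq_trans _ (sparse x p z pth (size_tuple p))) //.
  rewrite -sum1_card [leqRHS]big_mkcond /=; apply: leq_sum => y _.
  by rewrite inE; case: (_ && _).
have sum_B_split : \sum_(s : (j.+3 + j.+1).-tuple T) cycle_wt s * (beta (take j.+4 s))%:R
    = \sum_y \sum_z vwt y * vwt z * (B y z * walks j y z).
  rewrite (sum_closed_split _ _ (fun s => cycle_wt s * (beta (take j.+4 s))%:R)).
  apply: eq_bigr => y _; apply: eq_bigr => z _.
  have -> : B y z = \sum_(p : j.+2.-tuple T) walk_wt y p z * (beta (y :: rcons p z))%:R.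
    rewrite (sum_tuple_cons _ (fun p => walk_wt y p z * (beta (y :: rcons p z))%:R)).
    apply: eq_bigr => x _; rewrite mul1r mulrA mulr_sumr; apply: eq_bigr => p _.
    by rewrite walk_wt_cons !mulrA.
  rewrite [walks j y z]walksC /walks big_distrlr mulr_sumr /=.
  apply: eq_bigr => p _; rewrite mulr_sumr; apply: eq_bigr => q _.
  rewrite cycle_wt_cat -cat_rcons take_size_cat ?size_rcons ?size_tuple //.
  by set be := (beta _)%:R; ring.
have vwt_deg x : vwt x * (deg x)%:R <= 1.
  have [->|dx] := posnP (deg x); first by rewrite mulr0.
  by rewrite mulVf // pnatr_eq0 -lt0n.
have delta_vwt x : delta%:R * vwt x <= 1.
  have [dx0|dx] := posnP (deg x); first by rewrite /vwt dx0 invr0 mulr0.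
  by rewrite ler_pdivrMr ?ltr0n // mul1r ler_nat deg_min.
(* Cauchy-Schwarz over the neighbours [x] of [y]: it costs a factor [deg y], which [vwt y]
   cancels. *)
have B_sq y z : vwt y * B y z ^+ 2 <= \sum_x (adj y x)%:R * (vwt x * b y x z) ^+ 2.
  have := weighted_cauchy_schwarz (fun=> 1) (fun x => vwt x * b y x z)
    (fun x => ler0n R (adj y x)).
  under [X in _ <= X * _]eq_bigr => x _ do rewrite expr1n mulr1.
  rewrite sum_adj => /(ler_wpM2l (vwt_ge0 y)) /le_trans; apply.
  rewrite mulrA ler_piMl //; apply: sumr_ge0 => x _; rewrite mulr_ge0 ?sqr_ge0 //.
(* One factor [b] is bounded by [walks], the other is summed over [y] by [sum_b]. A surplus factor
   [vwt x] remains and absorbs [delta]. *)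
have sum_B : delta%:R * (\sum_y \sum_z vwt y * vwt z * B y z ^+ 2) <=
    sigma%:R * closed_walks (j.+2 + j.+2).
  have le1 : \sum_y \sum_z vwt y * vwt z * B y z ^+ 2 <=
      \sum_x \sum_z vwt z * vwt x ^+ 2 * (sigma%:R * walks j.+1 x z ^+ 2).
    rewrite exchange_big [leRHS]exchange_big /=; apply: ler_sum => z _.
    apply: (@le_trans _ _ (\sum_y vwt z * \sum_x (adj y x)%:R * (vwt x * b y x z) ^+ 2)).
      apply: ler_sum => y _; rewrite [vwt y * _]mulrC -mulrA.
      by rewrite ler_wpM2l ?vwt_ge0.
    rewrite -mulr_sumr exchange_big mulr_sumr /=; apply: ler_sum => x _.
    rewrite -mulrA ler_wpM2l ?vwt_ge0 //.
    apply: (@le_trans _ _ (vwt x ^+ 2 *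
        (\sum_y (adj y x)%:R * b y x z * walks j.+1 x z))).
      rewrite mulr_sumr; apply: ler_sum => y _.
      rewrite adj_sym exprMn mulrCA ler_wpM2l ?sqr_ge0 // -mulrA ler_wpM2l //.
      by rewrite expr2 ler_wpM2l.
    rewrite ler_wpM2l ?sqr_ge0 // -mulr_suml expr2 mulrA ler_wpM2r ?walks_ge0 //.
  apply: (le_trans (ler_wpM2l (ler0n _ _) le1)).
  rewrite closed_walks_split !mulr_sumr; apply: ler_sum => x _.
  rewrite !mulr_sumr; apply: ler_sum => z _.
  rewrite [leLHS](_ : _ = delta%:R * vwt x *
    (sigma%:R * (vwt x * vwt z * (walks j.+1 x z * walks j.+1 x z)))); last by ring.
  by rewrite ler_piMl // !mulr_ge0 ?vwt_ge0 ?walks_ge0.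
rewrite sum_B_split.
have vv0 (u : T * T) : 0 <= vwt u.1 * vwt u.2 by rewrite mulr_ge0 ?vwt_ge0.
have := weighted_cauchy_schwarz (fun u => B u.1 u.2) (fun u => walks j u.1 u.2) vv0.
rewrite -(pair_big xpredT xpredT (fun y z => vwt y * vwt z * (B y z * walks j y z))).
rewrite -(pair_big xpredT xpredT (fun y z => vwt y * vwt z * B y z ^+ 2)).
rewrite -(pair_big xpredT xpredT (fun y z => vwt y * vwt z * walks j y z ^+ 2)) /=.
under [X in _ <= _ * X]eq_bigr => y _ do under eq_bigr => z _ do rewrite expr2.
rewrite -closed_walks_split => /(ler_wpM2l (ler0n R delta)) /le_trans; apply.
rewrite !mulrA ler_wpM2r //.
by apply: sumr_ge0 => s _; apply: cycle_wt_ge0.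
Qed.

(* Only the ratio of the last two moments matters; by log-convexity it is the largest, and the product of all of them is at least [1 / #|T|]. *)
Lemma closed_walks_ratio k x0 y0 : adj x0 y0 ->
  closed_walks (k.+1 + k.+1) ^+ k.+2 <=
  #|T|%:R * closed_walks (k.+2 + k.+2) ^+ k.+2.
Proof.
move=> x0y0; have ge1 m := closed_walks_ge1 m x0y0.
have gt0 m := lt_le_trans ltr01 (ge1 m).
have T_gt0 : 0 < #|T|%:R :> R by rewrite ltr0n; apply/card_gt0P; exists x0.
(* The induction carries the exponent [k.+1] on the right; raising it is harmless since the moment
   is at least 1. *)
suff chain : closed_walks (k.+1 + k.+1) ^+ k.+2 <=
    #|T|%:R * closed_walks (k.+2 + k.+2) ^+ k.+1.
  apply: (le_trans chain); rewrite ler_wpM2l ?(ltW T_gt0) //.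
  by rewrite [leRHS]exprS ler_peMl ?exprn_ge0 ?(ltW (gt0 _)).
elim: k => [|k IHk]; first by rewrite expr1; exact: closed_walks2_le.
set a0 := closed_walks (k.+1 + _) in IHk *; set a1 := closed_walks (k.+2 + _) in IHk *.
set a2 := closed_walks (k.+3 + _).
have lc : a1 ^+ 2 <= a0 * a2.
  rewrite /a1 addSnnS; exact: closed_walks_cauchy_schwarz.
have a1_gt0 : 0 < a1 ^+ k.+1 by rewrite exprn_gt0 ?gt0.
(* The new left side is a power of [a1 ^+ 2], ready for [lc]; [IHk] then bounds [a0 ^+ k.+2]. *)
rewrite -(ler_pM2r a1_gt0) -exprD addnC.
have -> : (k.+1 + k.+3 = 2 * k.+2)%N by lia.
rewrite exprM (le_trans (_ : _ <= (a0 * a2) ^+ k.+2)) ?lerXn2r ?nnegrE //.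
- exact: sqr_ge0.
- by rewrite mulr_ge0 ?(ltW (gt0 _)).
rewrite exprMn [leRHS]mulrAC; apply: ler_wpM2r IHk.
by rewrite exprn_ge0 ?(ltW (gt0 _)).
Qed.

End WeightedWalks.

(** * Bad closed walks, up to rotation and reversal *)

Section BadWalks.
Variables (T : finType) (adj sim : rel T) (approx : rel {set T}) (j : nat) (x0 : T).
Hypothesis adj_sym : symmetric adj.
Let k := j.+2.
Let N := k + k.

Definition nth_edge (s : seq T) i := [set nth x0 s i; nth x0 s i.+1].

(** The far vertex or edge is the first argument of the relation: sparseness limits the second one,
    hence the choice of entry 0. Only entries up to [k.+1] are read. *)
Definition bad_start (s : seq T) : bool :=
  [exists l : 'I_k, [|| nth x0 s l.+1 == nth x0 s 0,
     sim (nth x0 s l.+1) (nth x0 s 0) | approx (nth_edge s l.+1) (nth_edge s 0)]].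

Definition bad_cycle (s : seq T) : bool :=
  [exists i : 'I_N, bad_start (rot i s) || bad_start (rot i (rev s))].

Lemma bad_start_take s : bad_start (take k.+2 s) = bad_start s.
Proof.
apply: eq_existsb => l; rewrite /nth_edge !nth_take //.
all: by have := ltn_ord l; lia.
Qed.

(** For each of the [k] offsets the start equals the far vertex, or is one of at most [r] neighbours
    of [x] excluded by [sim], or one of at most [r] excluded by [approx]. *)
Lemma bad_start_count (r : nat) x p z :
  (forall u v, #|[set w | adj v w && sim u w]| <= r) ->
  (forall u v w, adj u v ->
     #|[set y | adj w y && approx [set u; v] [set w; y]]| <= r) ->
  path adj x (rcons p z) -> size p = j.+1 ->
  #|[set y | adj y x & bad_start (y :: x :: rcons p z)]| <= k * (r + r).+1.
Proof.
move=> sim_sparse approx_sparse pth sz_p.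
pose u l := nth x0 (x :: rcons p z) l.
pose A (l : 'I_k) := u l |: ([set y | adj x y && sim (u l) y] :|:
  [set y | adj x y && approx [set u l; u l.+1] [set x; y]]).
apply: (@leq_trans #|\bigcup_l A l|).
  apply/subset_leq_card/subsetP => y; rewrite inE => /andP[yx /existsP[l bad_l]].
  apply/bigcupP; exists l => //; rewrite !inE adj_sym yx /=.
  by move: bad_l; rewrite /nth_edge /= [y == _]eq_sym [in X in approx _ X]setUC.
have cardA l : #|A l| <= (r + r).+1.
  rewrite (leq_trans (leq_card_setU _ _)) // cards1 ltnS.
  rewrite (leq_trans (leq_card_setU _ _)) // leq_add ?sim_sparse //.
  apply: approx_sparse; apply: (pathP x0 pth).
  by rewrite size_rcons sz_p.
apply: (@leq_trans (\sum_l #|A l|)).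
  apply: (big_ind2 (fun (B : {set T}) n => #|B| <= n)) => //; first by rewrite cards0.
  by move=> B1 n1 B2 n2 h1 h2; rewrite (leq_trans (leq_card_setU _ _)) // leq_add.
by rewrite (leq_trans (leq_sum _ (fun l _ => cardA l))) // sum_nat_const card_ord.
Qed.

Definition cnth (s : seq T) i := nth x0 s (i %% N).

Definition good_cycle (s : seq T) := forall a b, a < N -> b < N -> a != b ->
  [/\ cnth s a != cnth s b, ~~ sim (cnth s a) (cnth s b)
    & ~~ approx [set cnth s a; cnth s a.+1] [set cnth s b; cnth s b.+1]].

Lemma modn_small2 i : i < N + N -> i %% N = if i < N then i else i - N.
Proof.
move=> lt_i; case: ltnP => [/modn_small //|le_Ni].
by rewrite -{1}(subnK le_Ni) modnDr modn_small // ltn_subLR.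
Qed.

Lemma nth_rot s i m : size s = N -> i < N -> m < N ->
  nth x0 (rot i s) m = cnth s (i + m).
Proof.
move=> sz_s lt_iN lt_mN; rewrite /cnth modn_small2; last by lia.
rewrite /rot nth_cat size_drop sz_s nth_drop ltn_subRL.
case: ltnP => // le_N; rewrite nth_take; last by lia.
by congr nth; lia.
Qed.

Lemma nth_rot_rev s i m : size s = N -> i < N -> m < N ->
  nth x0 (rot i (rev s)) m = cnth s (N.-1 - i + (N - m)).
Proof.
move=> sz_s lt_iN lt_mN; rewrite nth_rot ?size_rev // /cnth !modn_small2; try lia.
rewrite nth_rev sz_s; last by case: ifP; lia.
by congr nth; do 2 case: ifP; lia.
Qed.

Lemma eq_cnth s i i' : [\/ i = i', i = i' + N | i + N = i'] -> cnth s i = cnth s i'.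
Proof. by case=> [->|->|<-] //; rewrite /cnth modnDr. Qed.

(* Seen from [b] the index [a] is at most [k] steps ahead, or fewer than [k] steps ahead once the walk is reversed. *)
Lemma good_cycleP s : size s = N -> ~~ bad_cycle s -> good_cycle s.
Proof.
move=> sz_s; rewrite negb_exists => /forallP good a b lt_aN lt_bN neq_ab.
have {}good i (lt_iN : i < N) := good (Ordinal lt_iN).
have fwd i (lt_iN : i < N) l (lt_lk : l < k) :
  [&& cnth s (i + l.+1) != cnth s i, ~~ sim (cnth s (i + l.+1)) (cnth s i)
    & ~~ approx [set cnth s (i + l.+1); cnth s (i + l.+2)] [set cnth s i; cnth s i.+1]].
  have := good i lt_iN; rewrite negb_or => /andP[+ _].
  rewrite negb_exists => /forallP/(_ (Ordinal lt_lk)) /=.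
  rewrite /nth_edge !negb_or !nth_rot ?addn0 ?addn1 //; lia.
have bwd i (lt_iN : i < N) l (lt_lk : l < k) : let i' := N.-1 - i in
  [&& cnth s (i' + (N - l.+1)) != cnth s (i' + N),
      ~~ sim (cnth s (i' + (N - l.+1))) (cnth s (i' + N))
    & ~~ approx [set cnth s (i' + (N - l.+1)); cnth s (i' + (N - l.+2))]
         [set cnth s (i' + N); cnth s (i' + (N - 1))]].
  have := good i lt_iN; rewrite negb_or => /andP[_].
  rewrite negb_exists => /forallP/(_ (Ordinal lt_lk)) /=.
  rewrite /nth_edge !negb_or !nth_rot_rev ?subn0 //; lia.
have k_gt1 : 1 < k by [].
have N_def : N = k + k by [].
(* [l] is the number of steps forward from [b] to [a], modulo [N]. *)
have [l l_spec] : exists l, (b < a /\ l + b = a) \/ (a < b /\ l + b = a + N).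
  by have [lt_ab|lt_ba|eq_ab] := ltngtP a b; [exists (a + N - b)|exists (a - b)|]; lia.
have [le_lk|lt_kl] := leqP l k.
  have lt_l : l.-1 < k by lia.
  have /and3P[] := fwd b lt_bN _ lt_l.
  rewrite (@eq_cnth s (b + _) a) 1?(@eq_cnth s (b + _.+2) a.+1); first by split.
  - by case: l_spec => ?; [constructor 1|constructor 2]; lia.
  - by case: l_spec => ?; [constructor 1|constructor 2]; lia.
have lt_l : (N - l).-1 < k by lia.
have lt_lN : l < N by lia.
have lt_b' : N.-1 - b < N by lia.
have /and3P[neq_v sim_v _] := bwd _ lt_b' _ lt_l.
(* Reversed, the edge at [b] is traversed from [b.+1], so for edges the reversed walk starts there;
   this is index 0 when [b.+1] is [N]. *)
pose c := if b.+1 == N then N.-1 else N.-1 - b.+1.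
have lt_c : c < N by rewrite /c; case: ifP; lia.
have /and3P[_ _ approx_e] := bwd _ lt_c _ lt_l.
move: neq_v sim_v approx_e.
rewrite !(@eq_cnth s (N.-1 - (N.-1 - b) + N) b); last by constructor 2; lia.
rewrite !(@eq_cnth s (N.-1 - (N.-1 - b) + _) a); last first.
  by case: l_spec => ?; [constructor 1|constructor 2]; lia.
rewrite (@eq_cnth s (N.-1 - c + (N - (N - l).-1.+1)) a.+1); last first.
  rewrite /c; case: ifP => ?; case: l_spec => ?;
    [constructor 3|constructor 1|constructor 1|constructor 2]; lia.
rewrite (@eq_cnth s (N.-1 - c + (N - (N - l).-1.+2)) a); last first.
  rewrite /c; case: ifP => ?; case: l_spec => ?;
    [constructor 3|constructor 1|constructor 1|constructor 2]; lia.
rewrite (@eq_cnth s (N.-1 - c + N) b.+1); last first.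
  by rewrite /c; case: ifP => ?; [constructor 1|constructor 2]; lia.
rewrite (@eq_cnth s (N.-1 - c + (N - 1)) b); last first.
  by rewrite /c; case: ifP => ?; [constructor 1|constructor 2]; lia.
by rewrite [in approx _ _]setUC [X in approx _ X]setUC; split.
Qed.

End BadWalks.

(* [4 ^ t.+1] is the density needed for the greedy choice, [2 * (k + k)] counts rotations and reversals, and [k * (r + r).+1] bounds the neighbours of [x_1] excluded as [x_0]. *)
Definition degree_threshold (j r t : nat) : nat :=
  (4 ^ t.+1 * (2 * (j.+2 + j.+2))) ^ 2 * (j.+2 * (r + r).+1).

(** * Averaging over closed walks and over their end points *)

Section Averaging.
Import Order.TTheory GRing.Theory Num.Theory.
Local Open Scope ring_scope.
Variables (T : finType) (adj sim : rel T) (approx : rel {set T}).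
Variables (j r t delta : nat) (x0 y0 : T).
Hypotheses (adj_sym : symmetric adj) (adj_x0y0 : adj x0 y0).
Hypothesis sim_sparse : forall u v, (#|[set w | adj v w && sim u w]| <= r)%N.
Hypothesis approx_sparse : forall u v w, adj u v ->
  (#|[set y | adj w y && approx [set u; v] [set w; y]]| <= r)%N.
Hypothesis deg_min : forall x, (0 < deg adj x -> delta <= deg adj x)%N.
Hypothesis delta_large : (degree_threshold j r t ^ j.+2 * #|T| <= delta ^ j.+2)%N.

Local Notation bad := (bad_cycle sim approx j x0).
Local Notation k := j.+2.
Local Notation W := (closed_walks rat adj).

Lemma bad_cycles_le : 4 ^+ t.+1 *
    (\sum_(s : (k + k).-tuple T) cycle_wt rat adj s * (bad s)%:R) <= W (k + k).
Proof.
pose start s := bad_start sim approx j x0 s.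
pose b0 : rat := \sum_(s : (k + k).-tuple T) cycle_wt rat adj s * (start s)%:R.
have rot_sum (i : 'I_(k + k)) (F : seq T -> rat) :
    \sum_(s : (k + k).-tuple T) F (rot i s) = \sum_(s : (k + k).-tuple T) F s.
  by apply: sum_tuple_rot; apply: ltnW.
(* The weight is invariant under rotation and reversal, so each of the [2 * (k + k)] readings
   contributes [b0]. *)
have union : \sum_(s : (k + k).-tuple T) cycle_wt rat adj s * (bad s)%:R
    <= (2 * (k + k))%:R * b0.
  have fwd (i : 'I_(k + k)) : b0 =
      \sum_(s : (k + k).-tuple T) cycle_wt rat adj s * (start (rot i s))%:R.
    rewrite /b0 -(rot_sum i (fun s => cycle_wt rat adj s * (start s)%:R)).
    by apply: eq_bigr => s _; rewrite cycle_wt_rot.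
  have bwd (i : 'I_(k + k)) : b0 =
      \sum_(s : (k + k).-tuple T) cycle_wt rat adj s * (start (rot i (rev s)))%:R.
    rewrite (fwd i) -(sum_tuple_rev _ (fun s => cycle_wt rat adj s * (start (rot i s))%:R)).
    by apply: eq_bigr => s _; rewrite cycle_wt_rev.
  have -> : (2 * (k + k))%:R * b0 = \sum_(i < k + k) (b0 + b0).
    by rewrite sumr_const card_ord -mulr2n -mulrnA mulr_natl.
  under [leRHS]eq_bigr => i _ do rewrite {1}(fwd i) (bwd i) -big_split.
  rewrite exchange_big /=; apply: ler_sum => s _.
  have w0 := cycle_wt_ge0 rat adj s.
  case: (boolP (bad s)) => [/existsP[i hi]|_]; last first.
    by rewrite /= mulr0; apply: sumr_ge0 => i _; apply: addr_ge0; apply: mulr_ge0.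
  rewrite (bigD1 i) //= mulr1 -mulrDr ler_wpDr //.
    by apply: sumr_ge0 => l _; apply: addr_ge0; apply: mulr_ge0.
  by rewrite ler_peMr // -natrD ler1n; case/orP: hi; rewrite /start => ->; rewrite ?addn1.
(* The event reads only the first [j.+4] vertices, which form the longer arc of the split
   [j.+3 + j.+1], end points included. *)
have b0_take : b0 = \sum_(s : (j.+3 + j.+1).-tuple T)
    cycle_wt rat adj s * (start (take j.+4 s))%:R.
  rewrite /b0 -addSnnS; apply: eq_bigr => s _.
  by rewrite /start bad_start_take.
have key : delta%:R * b0 ^+ 2 <= (k * (r + r).+1)%:R * (W (k + k) * W (j.+1 + j.+1)).
  rewrite b0_take; apply: sparse_event_bound => // x p z.
  exact: bad_start_count.
have ratio := closed_walks_ratio rat adj_sym j adj_x0y0.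
have W1 := closed_walks_ge1 rat adj_sym j.+1 adj_x0y0.
have W'1 := closed_walks_ge1 rat adj_sym j adj_x0y0.
have W_gt0 : 0 < W (k + k) by exact: lt_le_trans ltr01 W1.
have T_gt0 : (0 < #|T|)%N by apply/card_gt0P; exists x0.
have L_gt0 : (0 < degree_threshold j r t)%N by rewrite /degree_threshold !muln_gt0 !expn_gt0.
have delta_gt0 : (0 < delta)%N.
  rewrite lt0n; apply: contraTneq delta_large => ->.
  by rewrite exp0n // leqn0 -lt0n muln_gt0 expn_gt0 L_gt0 T_gt0.
(* Comparing [j.+2]-th powers avoids roots in [rat]: the factor [#|T|] of [ratio] is absorbed by
   [delta_large]. *)
have step : (degree_threshold j r t)%:R * W (j.+1 + j.+1) <= delta%:R * W (k + k).
  rewrite -(@ler_pXn2r _ j.+2) ?nnegrE //; last 2 first.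
  - by rewrite mulr_ge0 // (le_trans ler01 W'1).
  - by rewrite mulr_ge0 // ltW.
  rewrite !exprMn (le_trans (ler_wpM2l _ ratio)) ?exprn_ge0 //.
  rewrite mulrA ler_wpM2r ?exprn_ge0 ?(ltW W_gt0) //.
  by rewrite -!natrX -natrM ler_nat.
apply: (le_trans (ler_wpM2l _ union)); first by rewrite exprn_ge0.
set mu : rat := 4 ^+ t.+1 * (2 * (k + k))%:R.
have b0_ge0 : 0 <= b0 by apply: sumr_ge0 => s _; rewrite mulr_ge0 ?cycle_wt_ge0.
have mu_ge0 : 0 <= mu by rewrite mulr_ge0 ?exprn_ge0.
(* After squaring and multiplying by [delta], [key] bounds the left side by [W (k + k)] times the
   left side of [step]; hence the factor [mu ^+ 2] in [degree_threshold]. *)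
rewrite mulrA -/mu -(@ler_pXn2r _ 2) //; last 2 first.
- by rewrite nnegrE; apply: mulr_ge0.
- by rewrite nnegrE ltW.
rewrite -(@ler_pM2l _ delta%:R) ?ltr0n // exprMn mulrCA.
apply: (le_trans (ler_wpM2l _ key)); first by rewrite exprn_ge0.
rewrite [leRHS](_ : _ = W (k + k) * (delta%:R * W (k + k))); last by ring.
rewrite [leLHS](_ : _ = W (k + k) * ((degree_threshold j r t)%:R * W (j.+1 + j.+1))).
  by rewrite ler_pM2l.
have -> : (degree_threshold j r t)%:R = mu ^+ 2 * (k * (r + r).+1)%:R :> rat.
  by rewrite /degree_threshold natrM natrX natrM natrX.
ring.
Qed.

Lemma exists_good_walks : exists (x y : T) (l : seq (j.+1.-tuple T)),
  [/\ size l = t, all (fun p : j.+1.-tuple T => path adj x (rcons p y)) l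
    & pairwise (fun p q : j.+1.-tuple T => ~~ bad (x :: p ++ y :: rev q)) l].
Proof.
pose w x y (p : j.+1.-tuple T) := walk_wt rat adj x p y.
pose B x y := \sum_p \sum_q w x y p * w x y q * (bad (x :: p ++ y :: rev q))%:R.
have W_split := closed_walks_split rat adj_sym j.+1 j.+1.
have bad_split : \sum_(s : (k + k).-tuple T) cycle_wt rat adj s * (bad s)%:R =
    \sum_x \sum_y vwt rat adj x * vwt rat adj y * B x y.
  rewrite (sum_closed_split _ _ (fun s => cycle_wt rat adj s * (bad s)%:R)).
  apply: eq_bigr => x _; apply: eq_bigr => y _; rewrite mulr_sumr.
  apply: eq_bigr => p _; rewrite mulr_sumr.
  (* Reversing the second arc makes it a walk from [x] to [y], like the first. *)
  rewrite -(sum_tuple_rev _ (fun q => cycle_wt rat adj (x :: p ++ y :: q) *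
    (bad (x :: p ++ y :: q))%:R)).
  by apply: eq_bigr => q _; rewrite cycle_wt_cat (walk_wt_rev _ adj_sym) !mulrA.
have W1 := closed_walks_ge1 rat adj_sym j.+1 adj_x0y0.
have vv0 x y : 0 <= vwt rat adj x * vwt rat adj y by rewrite mulr_ge0 ?vwt_ge0.
(* If no pair worked, [bad_cycles_le] would make [W (k + k)] at most a quarter of itself, against
   [W1]. *)
have [[x y] /= dense] : exists u : T * T,
    4 ^+ t * (vwt rat adj u.1 * vwt rat adj u.2 * B u.1 u.2) <
    vwt rat adj u.1 * vwt rat adj u.2 * walks rat adj j.+1 u.1 u.2 ^+ 2.
  apply/existsP; move: W1; apply: contraLR; rewrite negb_exists -ltNge => /forallP H.
  have le1 : W (k + k) <= 4 ^+ t * (\sum_x \sum_y vwt rat adj x * vwt rat adj y * B x y).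
    rewrite W_split !mulr_sumr; apply: ler_sum => x _; rewrite mulr_sumr.
    by apply: ler_sum => y _; have := H (x, y); rewrite -leNgt /= expr2.
  move: bad_cycles_le le1; rewrite bad_split exprS -mulrA.
  move: (W _) (4 ^+ t * _) => {H bad_split B w} a b; lra.
have B0 : 0 <= B x y.
  by apply: sumr_ge0 => p _; apply: sumr_ge0 => q _;
    apply: mulr_ge0 => //; apply: mulr_ge0; apply: walk_wt_ge0.
have vv_gt0 : 0 < vwt rat adj x * vwt rat adj y.
  rewrite lt_neqAle vv0 andbT; apply: contraTneq dense => <-.
  by rewrite !mul0r mulr0 ltxx.
move: dense; rewrite mulrCA ltr_pM2l // => dense.
have w_gt0 : 0 < \sum_p w x y p.
  rewrite lt_neqAle sumr_ge0 ?andbT => [|p _]; last exact: walk_wt_ge0.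
  apply: contraTneq dense; rewrite /walks -/(w x y _) => <-.
  by rewrite expr0n ltNge mulr_ge0 ?exprn_ge0.
have [|l [sz_l /allP l_pos l_good]] := pairwise_good_selection
  (bad := fun p q : j.+1.-tuple T => bad (x :: p ++ y :: rev q)) _ w_gt0 (ltW dense).
  by move=> p; apply: walk_wt_ge0.
exists x, y, l; split=> //; apply/allP => p /l_pos; rewrite /w /walk_wt.
by case: (path _ _ _); rewrite // mul0r ltxx.
Qed.

End Averaging.

(** * Assembling the theta graph *)

Section Theta.
Variables (T : finType) (adj sim : rel T) (approx : rel {set T}) (j : nat) (x0 x y : T).
Let k := j.+2.
Let N := k + k.
Implicit Types q : j.+1.-tuple T.

Definition arc q m := nth x0 (x :: rcons q y) m.

Definition closed q q' := x :: q ++ y :: rev q'.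

(** The second arc is traversed backwards in the closed walk, so its vertex [m] sits at [N - m],
    except that the common start stays at 0; its edge [m] begins at [N - m.+1]. *)
Definition vpos (second : bool) m := if second && (m != 0) then N - m else m.
Definition epos (second : bool) m := if second then N - m.+1 else m.

Lemma arc_cnth q q' (second : bool) m : m <= k ->
  arc (if second then q' else q) m = cnth j x0 (closed q q') (vpos second m).
Proof.
move=> le_mk; have N_def : N = j.+2 + j.+2 by [].
have k_def : k = j.+2 by [].
have lt_pos : vpos second m < N by rewrite /vpos; case: ifP; lia.
rewrite /cnth modn_small // /vpos.
case: second {lt_pos} => /=; last first.
  by rewrite /arc /closed -cat_rcons -cat_cons nth_cat /= size_rcons size_tuple ltnS le_mk.
case: m le_mk => [|m] le_mk //=.
rewrite /closed -cat_cons nth_cat /= size_tuple -rev_rcons /arc [LHS]/=.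
case: ltnP => [|_]; first by lia.
rewrite nth_rev; rewrite size_rcons size_tuple; last by lia.
by congr nth; lia.
Qed.

Lemma arc_edge q q' (second : bool) m : m < k ->
  let p := if second then q' else q in let s := closed q q' in
  [set arc p m; arc p m.+1] =
  [set cnth j x0 s (epos second m); cnth j x0 s (epos second m).+1].
Proof.
move=> lt_mk; have N_def : N = j.+2 + j.+2 by [].
have k_def : k = j.+2 by [].
rewrite /= !(arc_cnth q q' second) ?(ltnW lt_mk) // /vpos /epos.
case: second => //=; rewrite setUC; congr [set _; _].
case: m lt_mk => [|m] lt_mk /=; last by congr cnth; lia.
by apply: eq_cnth; constructor 3; lia.
Qed.

(** Any two of the paths lie on a common good closed walk, so each condition on a pair of vertices
    or edges reduces to their positions being distinct. *)
Lemma theta_of_good_walks (t : nat) (l : seq (j.+1.-tuple T)) :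
  2 <= t -> size l = t -> all (fun q => path adj x (rcons q y)) l ->
  pairwise (fun q q' => ~~ bad_cycle sim approx j x0 (closed q q')) l ->
  exists p : 'I_t -> nat -> T,
    theta_copy adj k x y p /\ vertex_good sim k p /\ edge_good approx k p.
Proof.
move=> t_ge2 sz_l /allP l_path l_good.
pose q0 : j.+1.-tuple T := [tuple of nseq j.+1 x0].
pose Q (i : 'I_t) := nth q0 l i.
have good (i i' : 'I_t) : i < i' -> good_cycle sim approx j x0 (closed (Q i) (Q i')).
  move=> lt_ii'; apply: good_cycleP.
    by rewrite /= size_cat /= size_rev !size_tuple; lia.
  by move/(pairwiseP q0): l_good; apply; rewrite ?inE ?sz_l.
have sides i i' : exists s (b b' : bool),
    [/\ good_cycle sim approx j x0 s, (b == b') = (i == i'),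
        (forall m, m <= k -> arc (Q i) m = cnth j x0 s (vpos b m)) /\
        (forall m, m < k -> [set arc (Q i) m; arc (Q i) m.+1] =
          [set cnth j x0 s (epos b m); cnth j x0 s (epos b m).+1])
      & (forall m, m <= k -> arc (Q i') m = cnth j x0 s (vpos b' m)) /\
        (forall m, m < k -> [set arc (Q i') m; arc (Q i') m.+1] =
          [set cnth j x0 s (epos b' m); cnth j x0 s (epos b' m).+1])].
  have view u v (c : bool) :
    let P := if c then Q v else Q u in let s := closed (Q u) (Q v) in
    (forall m, m <= k -> arc P m = cnth j x0 s (vpos c m)) /\
    (forall m, m < k -> [set arc P m; arc P m.+1] =
      [set cnth j x0 s (epos c m); cnth j x0 s (epos c m).+1]).
    by split=> m ?; [apply: arc_cnth | apply: arc_edge].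
  have [lt_ii'|lt_i'i|eq_ii'] := ltngtP i i'.
  - exists (closed (Q i) (Q i')), false, true; split.
    + exact: good.
    + by apply/esym/negbTE; rewrite neq_ltn lt_ii'.
    + exact: (view i i' false).
    + exact: (view i i' true).
  - exists (closed (Q i') (Q i)), true, false; split.
    + exact: good.
    + by apply/esym/negbTE; rewrite neq_ltn lt_i'i orbT.
    + exact: (view i' i true).
    + exact: (view i' i false).
  (* A path is compared with itself inside its closed walk with another path, which [2 <= t]
     provides. *)
  have {eq_ii'} <- : i = i' by apply: val_inj.
  have [i1 neq_i1] : exists i1 : 'I_t, i1 != i.
    have [i_eq0|i_neq0] := eqVneq (val i) 0.
      by exists (Ordinal t_ge2); rewrite -val_eqE i_eq0.
    by exists (Ordinal (ltnW t_ge2)); rewrite -val_eqE eq_sym.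
  move: neq_i1; rewrite neq_ltn => /orP[lt_i1|lt_i1].
  - exists (closed (Q i1) (Q i)), true, true.
    by split; [exact: good | rewrite !eqxx | exact: (view i1 i true)..].
  - exists (closed (Q i) (Q i1)), false, false.
    by split; [exact: good | rewrite !eqxx | exact: (view i i1 false)..].
have N_def : N = j.+2 + j.+2 by [].
have k_def : k = j.+2 by [].
have vpos_lt b m : m <= k -> vpos b m < N by rewrite /vpos; case: ifP; lia.
have epos_lt b m : m < k -> epos b m < N by rewrite /epos; case: ifP; lia.
exists (fun i => arc (Q i)); split; [split; [|split] | split].
- by move=> i; split; rewrite // /arc /= nth_rcons size_tuple ltnn eqxx.
- move=> i m lt_mk; have Q_path : path adj x (rcons (Q i) y).
    by apply: l_path; rewrite mem_nth ?sz_l.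
  by apply: (pathP x0 Q_path); rewrite size_rcons size_tuple.
- move=> i i' m m' le_m le_m'.
  have [s [b [b' [s_good eq_b [v_i _] [v_i' _]]]]] := sides i i'.
  rewrite v_i // v_i' // => eq_v.
  have eq_pos : vpos b m = vpos b' m'.
    apply/eqP; apply: contraT => neq_pos.
    have [] := s_good _ _ (vpos_lt b m le_m) (vpos_lt b' m' le_m') neq_pos.
    by rewrite eq_v eqxx.
  (* Positions are injective on one arc, and the two arcs share only the positions 0 and [k]. *)
  move: eq_pos; rewrite /vpos.
  have [eq_ii'|neq_ii'] := eqVneq i i'.
    move: eq_b; rewrite eq_ii' eqxx => /eqP <-.
    by case: b {v_i v_i' eq_v} => /= h; split; first [by left | by move: h; do 2 case: eqP => ? /=; lia | done].
  move: eq_b; rewrite (negPf neq_ii').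
  by case: b b' {v_i v_i' eq_v} => -[] //= _; case: eqP => /= ? ?; split; lia.
- move=> i i' m m' le_m le_m'.
  have [s [b [b' [s_good _ [v_i _] [v_i' _]]]]] := sides i i'.
  rewrite v_i // v_i' // => neq_v.
  have neq_pos : vpos b m != vpos b' m' by apply: contraNneq neq_v => ->.
  by have [] := s_good _ _ (vpos_lt b m le_m) (vpos_lt b' m' le_m') neq_pos.
- move=> i i' m m' lt_m lt_m'.
  have [s [b [b' [s_good _ [_ e_i] [_ e_i']]]]] := sides i i'.
  rewrite e_i // e_i' // => neq_e.
  have neq_pos : epos b m != epos b' m' by apply: contraNneq neq_e => ->.
  by have [] := s_good _ _ (epos_lt b m lt_m) (epos_lt b' m' lt_m') neq_pos.
Qed.

End Theta.

(** * Passing to a subgraph of large minimum degree *)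

Section MinDegree.
Variables (T : finType) (adj : rel T).
Hypothesis adj_sym : symmetric adj.

(** The vertex type is kept and vertices outside [S] become isolated, which is why minimum degree is
    only asked of vertices of positive degree. *)
Definition induced (S : {set T}) : rel T := [rel x y | [&& x \in S, y \in S & adj x y]].

Lemma induced_sym S : symmetric (induced S).
Proof. by move=> x y; rewrite /induced /= adj_sym andbCA. Qed.

(** The vertex [v] contributes its own degree, and one to the degree of each neighbour. *)
Lemma sum_deg_delete (S : {set T}) v :
  \sum_x deg (induced S) x <=
  \sum_x deg (induced (S :\ v)) x + 2 * deg (induced S) v.
Proof.
have deg_v : deg (induced S) v = \sum_x induced S x v.
  rewrite /deg -sum1_card big_mkcond; apply: eq_bigr => x _.
  by rewrite inE induced_sym; case: (induced S x v).
have deg_v' : deg (induced S) v = \sum_x (x == v) * deg (induced S) v.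
  by rewrite (bigD1 v) //= eqxx mul1n big1 ?addn0 // => x /negPf ->.
rewrite mul2n -addnn {1}deg_v deg_v' -!big_split /=; apply: leq_sum => x _.
have [->|neq_xv] := eqVneq x v; first by rewrite mul1n addnA leq_addl.
rewrite mul0n addn0 /deg (cardsD1 v) addnC inE leq_add2r subset_leq_card //.
by apply/subsetP => y; rewrite !inE /induced /= !inE neq_xv => /and4P[-> -> -> ->].
Qed.

(** Deleting a vertex of degree at most [d] lowers the degree sum by at most [2 * d], so the strict
    density bound survives until no such vertex is left. *)
Lemma min_degree_subset (d : nat) (S : {set T}) :
  2 * d * #|S| < \sum_x deg (induced S) x ->
  exists2 S' : {set T}, 0 < \sum_x deg (induced S') x
    & forall x, x \in S' -> d < deg (induced S') x.
Proof.
have [m le_m] := ubnP #|S|; elim: m => // m IHm in S le_m *.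
move=> dense; have [/forallP min|] := boolP [forall x, (x \in S) ==> (d < deg (induced S) x)].
  exists S; first exact: leq_ltn_trans dense.
  by move=> x; apply/implyP.
rewrite negb_forall => /existsP[v]; rewrite negb_imply -leqNgt => /andP[vS deg_v].
have cardS : #|S| = #|S :\ v|.+1 by rewrite (cardsD1 v) vS.
apply: (IHm (S :\ v)); first by rewrite cardS in le_m.
by have := sum_deg_delete S v; rewrite cardS in dense; lia.
Qed.

Lemma card_edge_set : #|edge_set adj| <= \sum_x deg adj x.
Proof.
have -> : \sum_x deg adj x = #|[set u : T * T | adj u.1 u.2]|.
  transitivity (\sum_x \sum_y (adj x y : nat)).
    apply: eq_bigr => x _; rewrite /deg -sum1_card big_mkcond.
    by apply: eq_bigr => y _; rewrite inE.
  rewrite pair_big -sum1_card [RHS]big_mkcond.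
  by apply: eq_bigr => u _; rewrite inE.
apply: leq_trans (leq_imset_card (fun u : T * T => [set u.1; u.2]) _).
apply/subset_leq_card/subsetP => e; rewrite inE => /existsP[u /existsP[v /andP[uv /eqP ->]]].
by apply/imsetP; exists (u, v); rewrite // inE.
Qed.

End MinDegree.

(** Sparseness of both relations passes to the induced subgraph, and a theta copy found there is one
    in the whole graph. *)
Lemma theta_of_dense (T : finType) (adj sim : rel T) (approx : rel {set T})
    (j t r d : nat) :
  symmetric adj -> 2 <= t ->
  (forall u v, #|[set w | adj v w && sim u w]| <= r) ->
  (forall u v w, adj u v ->
     #|[set z | adj w z && approx [set u; v] [set w; z]]| <= r) ->
  2 * d * #|T| < \sum_x deg adj x ->
  degree_threshold j r t ^ j.+2 * #|T| <= d ^ j.+2 ->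
  exists (x y : T) (p : 'I_t -> nat -> T),
    theta_copy adj j.+2 x y p /\ vertex_good sim j.+2 p /\ edge_good approx j.+2 p.
Proof.
move=> adj_sym t_ge2 sim_sparse approx_sparse dense d_large.
have full x : deg (induced adj setT) x = deg adj x.
  by apply: eq_card => y; rewrite !inE /induced /= !inE.
have [|S S_edges S_deg] := @min_degree_subset _ _ adj_sym d setT.
  by rewrite cardsT (eq_bigr _ (fun x _ => full x)).
have adjS_sym := induced_sym adj_sym S.
have sub (A B : pred T) (C : pred T) : (forall z, A z -> B z) ->
    #|[set z | A z && C z]| <= #|[set z | B z && C z]|.
  move=> AB; apply/subset_leq_card/subsetP => z; rewrite !inE.
  by case/andP => /AB -> ->.
have [x0 [y0 xy0]] : exists x0 y0, induced adj S x0 y0.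
  have [x0 dx0] : exists x0, 0 < deg (induced adj S) x0.
    apply/existsP; apply: contraLR S_edges; rewrite negb_exists -leqNgt => /forallP h.
    by rewrite big1 // => x _; apply/eqP; rewrite -leqn0 leqNgt h.
  by exists x0; move: dx0 => /card_gt0P[y0]; rewrite inE; exists y0.
have [|||x [y [l [sz_l l_path l_good]]]] := @exists_good_walks T (induced adj S)
    sim approx j r t d x0 y0 adjS_sym xy0 _ _ _ d_large.
- by move=> u v; apply: leq_trans (sim_sparse u v); apply: sub => z /and3P[].
- move=> u v w /and3P[_ _ uv]; apply: leq_trans (approx_sparse u v w uv).
  by apply: sub => z /and3P[].
- move=> x /card_gt0P[y]; rewrite inE => /and3P[xS _ _]; exact/ltnW/S_deg.
have [p [[ends [steps inj]] good]] := theta_of_good_walks t_ge2 sz_l l_path l_good.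
exists x, y, p; split=> //; split=> //; split=> // i m lt_m.
by have /and3P[] := steps i m lt_m.
Qed.

(* From the real edge bound to an integer degree *)
From Stdlib Require Import Reals Lra.

Lemma INR_expn m n : INR (expn m n) = (INR m ^ n)%R.
Proof. by elim: n => //= n IHn; rewrite expnS mult_INR IHn. Qed.

(* Taking [d] just below half the average degree, the threshold survives rounding because [n ^ (1 / k) >= 1]. *)
Lemma average_degree_split (k M n e : nat) : 0 < k -> 0 < n ->
  (2 * (INR M + 1) * Rpower (INR n) (1 + / INR k) <= INR e)%R ->
  exists2 d : nat, 2 * d * n < e & expn M k * n <= expn d k.
Proof.
move=> k_gt0 n_gt0 e_large.
have n_ge1 : (1 <= INR n)%R by rewrite -[1%R]/(INR 1); apply: le_INR; apply/leP.
have k_pos : (0 < INR k)%R by apply: lt_0_INR; apply/ltP.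
set y := Rpower (INR n) (/ INR k).
have y_ge1 : (1 <= y)%R.
  rewrite -(Rpower_O (INR n)); last by Lra.lra.
  apply: Rle_Rpower => //; apply: Rlt_le; exact: Rinv_0_lt_compat.
have yk : (y ^ k = INR n)%R.
  rewrite -Rpower_pow; last by Lra.lra.
  rewrite Rpower_mult Rinv_l ?Rpower_1 //; Lra.lra.
move: e_large; rewrite Rpower_plus Rpower_1 -/y; last by Lra.lra.
move=> e_large; have M_ge0 := pos_INR M.
have e_gt0 : 0 < e.
  apply/ltP/INR_lt; apply: Rlt_le_trans e_large.
  by rewrite -[INR 0]/0%R; apply: Rmult_lt_0_compat; [Lra.lra | apply: Rmult_lt_0_compat; Lra.lra].
(* The largest [d] with [2 * d * n < e]; the predecessor makes the inequality strict. *)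
pose d := e.-1 %/ (2 * n); have := divn_eq e.-1 (2 * n).
have := @ltn_pmod e.-1 (2 * n); rewrite muln_gt0 n_gt0 -/d => /(_ isT) r_lt e_eq.
exists d; first by lia.
have e_le : e <= 2 * n * d.+1 by lia.
have {}e_le : (INR e <= 2 * INR n * (INR d + 1))%R.
  rewrite -S_INR -[2%R]/(INR 2) -!mult_INR; apply: le_INR; exact/leP.
have My : (INR M * y <= INR d)%R.
  suff : ((INR M + 1) * y <= INR d + 1)%R by Lra.lra.
  apply: (@Rmult_le_reg_l (2 * INR n)); [Lra.lra | apply: Rle_trans e_le].
  apply: Rle_trans e_large; Lra.lra.
apply/leP/INR_le; rewrite mult_INR !INR_expn -yk -Rpow_mult_distr.
apply: pow_incr; split=> //; apply: Rmult_le_pos; Lra.lra.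
Qed.

Theorem theorem3p7 (k t s : nat) (hk : 2 <= k) (ht : 2 <= t) (hs : 0 < s) :
  exists C : R, (0 < C)%R /\
  forall (T : finType) (adj : rel T) (sim : rel T) (approx : rel {set T}),
    simple_graph adj ->
    0 < #|T| ->
    (C * Rpower (INR #|T|) (1 + / INR k) <= INR #|edge_set adj|)%R ->
    symmetric sim ->
    (forall u v : T, #|[set w | adj v w && sim u w]| <= s) ->
    (forall u v w : T, adj u v ->
        #|[set z | adj w z && approx [set u; v] [set w; z]]| <= s) ->
    exists (x y : T) (p : 'I_t -> nat -> T),
      theta_copy adj k x y p /\ vertex_good sim k p /\ edge_good approx k p.
Proof.
case: k hk => [|[|j]] // _; set M := degree_threshold j s t.
(* The factor 2 pays for the passage to minimum degree, the [+ 1] for rounding the degree down. *)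
exists (2 * (INR M + 1))%R; split; first by have := pos_INR M; Lra.lra.
move=> T adj sim approx [adj_sym _] T_gt0 many_edges _ sim_sparse approx_sparse.
have [|d lt_d M_le] := @average_degree_split j.+2 M #|T| (\sum_x deg adj x) isT T_gt0.
  by apply: Rle_trans many_edges _; apply/le_INR/leP/card_edge_set.
exact: (theta_of_dense adj_sym ht sim_sparse approx_sparse lt_d M_le).
Qed.
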